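(* Let $\lambda>0$, $\sigma\in(0,1)$ and $b\in(0,1)$. Consider the competitive search economy with buyer-seller ratio $\lambda$, fraction $\sigma$ of low type buyers with budget $b$, and sellers who each choose an auction format (first-price, second-price, or all-pay) and a reserve price in $[0,1]$. If $b>\sigma$, then in the unique symmetric equilibrium all sellers select the all-pay auction format.
   Context: Economy. There is a large number of risk-neutral buyers and sellers, with buyer-seller ratio $\lambda$. Each seller has one unit of a good, with reservation value $0$; each buyer wants one unit and values it at $1$. A fraction $\sigma$ of buyers are ''low types'' who can pay at most $b<1$; the others are ''high types'' who can pay up to $1$. A buyer's type is private information. Game. First, sellers simultaneously choose a format $m$ and a reserve price $r_m\in[0,1]$. Then buyers observe all postings and each selects one store. If a buyer is alone at the store, he pays the reserve price and gets the good. If $n\ge2$ buyers are present, they bid according to the format (and the reserve price plays no role). First-price and second-price auctions give identical payoffs to all parties and are treated as one ''standard'' format, $m=s$; the all-pay format is $m=ap$. Payoffs in a store. High and low types arrive at a store as independent Poisson variables with rates $x_h,x_l\ge 0$. Put $z_n(x)=e^{-x}x^n/n!$ and, for $x_h+x_l>0$, $\theta=x_l/(x_h+x_l)$. Let $u_{i,m}(n)$ be the expected equilibrium payoff of a type $i\in\{h,l\}$ buyer and $\pi_m(n)$ the seller's expected profit when $n$ customers are present. Then $u_{h,m}(1)=u_{l,m}(1)=1-r_m$ and $\pi_m(1)=r_m$, and for $n\ge2$: - standard: $u_{h,s}(n)=\theta^{n-1}(1-b)$, $u_{l,s}(n)=\frac{\theta^{n-1}}{n}(1-b)$, $\pi_s(n)=[\theta^n+n\theta^{n-1}(1-\theta)]b+1-\theta^n-n\theta^{n-1}(1-\theta)$;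 - all-pay: $u_{h,ap}(n)=\max(\theta^{n-1}-b,0)$, $u_{l,ap}(n)=\max(\theta^{n-1}/n-b,0)$, and $\pi_{ap}(n)$ is the expected sum of bids, equal to $1-n(1-\theta)u_{h,ap}(n)-n\theta u_{l,ap}(n)$. Expected utilities and profit: $$U_{i,m}(r_m,x_h,x_l)=\sum_{n=0}^\infty z_n(x_h+x_l)\,u_{i,m}(n+1),\qquad \Pi_m(r_m,x_h,x_l)=\sum_{n=1}^\infty z_n(x_h+x_l)\,\pi_m(n).$$ Buyers' responses. Let $\Omega_i$ be the market utility, i.e. the maximum expected utility a type $i$ buyer can obtain in the entire market. A seller posting $(m,r_m)$ attracts arrival rates $x_{h,m},x_{l,m}\ge0$ such that, for $i=h,l$, $U_{i,m}(r_m,x_{h,m},x_{l,m})=\Omega_i$ if $x_{i,m}>0$, and $x_{i,m}=0$ if $U_{i,m}(r_m,x_{h,m},x_{l,m})<\Omega_i$ (and $U_{i,m}\le\Omega_i$ in every case). Symmetric equilibrium. All sellers post the same $(m,r_m)$; buyers' visiting strategies are symmetric, so each store receives high types at rate $(1-\sigma)\lambda$ and low types at rate $\sigma\lambda$, and $\Omega_i=U_{i,m}(r_m,(1-\sigma)\lambda,\sigma\lambda)$; and no seller can obtain a strictly higher expected profit by posting some other $(m',r')$, $m'\in\{s,ap\}$, $r'\in[0,1]$, when, with $\Omega_h,\Omega_l$ taken as given, the arrival rates $x_{h,m'},x_{l,m'}\ge0$ at his store satisfy, for $i=h,l$, $U_{i,m'}(r',x_{h,m'},x_{l,m'})\le\Omega_i$,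 with equality if $x_{i,m'}>0$. *)

(* Defs.v *)
From Stdlib Require Import Reals Factorial.
From Coquelicot Require Import Coquelicot.
Open Scope R_scope.

(** First-price and second-price auctions give all parties the same payoffs
    and form the single format [standard]. *)
Inductive format : Set := standard | all_pay.

Inductive buyer_type : Set := high | low.

Record posting : Set := Posting { fmt : format; reserve : R }.

Definition z (n : nat) (x : R) : R := exp (- x) * x ^ n / INR (fact n).

(** At a store with [xh = xl = 0] the value of [theta] is irrelevant: every
    term of [U] and [Pi] that depends on it carries the factor
    [z n 0 = 0], [n >= 1]. *)
Definition theta (xh xl : R) : R := xl / (xh + xl).

(** Payoff of a buyer when [n] customers are present; [n = 0] is a dummy
    value that [U] never uses. *)
Definition buyer_payoff (b : R) (i : buyer_type) (p : posting) (t : R) (n : nat)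
    : R :=
  match n with
  | 0%nat => 0
  | 1%nat => 1 - reserve p
  | _ =>
      match fmt p, i with
      | standard, high => t ^ (n - 1) * (1 - b)
      | standard, low => t ^ (n - 1) / INR n * (1 - b)
      | all_pay, high => Rmax (t ^ (n - 1) - b) 0
      | all_pay, low => Rmax (t ^ (n - 1) / INR n - b) 0
      end
  end.

(** In the all-pay format the profit is the expected sum of bids: the good is
    always sold, at total surplus 1, so it is 1 minus the buyers' payoffs. *)
Definition seller_payoff (b : R) (p : posting) (t : R) (n : nat) : R :=
  match n with
  | 0%nat => 0
  | 1%nat => reserve p
  | _ =>
      match fmt p with
      | standard =>
          (t ^ n + INR n * t ^ (n - 1) * (1 - t)) * b
          + 1 - t ^ n - INR n * t ^ (n - 1) * (1 - t)
      | all_pay =>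
          1 - INR n * (1 - t) * buyer_payoff b high p t n
            - INR n * t * buyer_payoff b low p t n
      end
  end.

Definition U (b : R) (i : buyer_type) (p : posting) (xh xl : R) : R :=
  Series (fun n => z n (xh + xl) * buyer_payoff b i p (theta xh xl) (S n)).

(** The sum over [n >= 1], reindexed. *)
Definition Pi (b : R) (p : posting) (xh xl : R) : R :=
  Series (fun n => z (S n) (xh + xl) * seller_payoff b p (theta xh xl) (S n)).

Definition rate (xh xl : R) (i : buyer_type) : R :=
  match i with high => xh | low => xl end.

(** Arrival rates consistent with optimal buyer search at a store posting [p],
    given the market utilities [Omega]. *)
Definition response (b : R) (Omega : buyer_type -> R) (p : posting) (xh xl : R)
    : Prop :=
  0 <= xh /\ 0 <= xl /\
  forall i : buyer_type,
    U b i p xh xl <= Omega i /\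
    (0 < rate xh xl i -> U b i p xh xl = Omega i).

(** No consistent arrival rates may make a deviation strictly profitable; a
    deviation that admits no consistent (finite) arrival rates imposes no
    restriction. *)
Definition symmetric_equilibrium (lambda sigma b : R) (p : posting) : Prop :=
  let xh := (1 - sigma) * lambda in
  let xl := sigma * lambda in
  let Omega := fun i => U b i p xh xl in
  0 <= reserve p <= 1 /\
  forall p' : posting,
    0 <= reserve p' <= 1 -> p' <> p ->
    forall xh' xl' : R,
      response b Omega p' xh' xl' ->
      ~ Pi b p xh xl < Pi b p' xh' xl'.

(* Main.v *)
(** Since the good is sold whenever somebody comes, the profit at arrival rates
    [xh], [xl] is the surplus [1 - exp (- (xh + xl))] minus the utilities
    [xh * U_h + xl * U_l] left to the buyers. When the share of low types is at
    most [b], the all-pay format leaves no rent to either type at a contested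
    store, so at reserve 0 all buyers have market utility [exp (- lambda)], and
    [1 - exp (- x) - x * exp (- lambda)] is maximal at [x = lambda]. With a
    reserve in (0, 1) in the all-pay format, dropping it to 0 raises profit; at
    reserve 1, a standard store that draws only high types does better.

    Suppose all sellers post the standard format, so that high types are dearer
    than low types. A deviator posts the all-pay format and aims at a total rate
    [x <= lambda] and a share [t > b] of low types for which the all-pay payoffs
    of the two types differ by [Omega_h - Omega_l]; a reserve price then adjusts
    the level. As [t > b > sigma] he serves fewer of the dear high types. The
    difficulty is to choose [x] so that this reserve lies in [0, 1]. *)

Require Import Defs.
From Stdlib Require Import Reals Factorial Lra Lia.
From Coquelicot Require Import Coquelicot.
Open Scope R_scope.
Set Bullet Behavior "Strict Subproofs".

(** * Poisson means *)

(** Expectation of [f] at a Poisson variable of mean [x]. Resting on [is_series], it records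
    convergence, which an equation about [Series] does not. *)
Definition is_mean (x : R) (f : nat -> R) (v : R) : Prop :=
  is_series (fun n => z n x * f n) v.

Definition dirac (k n : nat) : R := if Nat.eqb n k then 1 else 0.

Lemma z_ge0 (n : nat) (x : R) : 0 <= x -> 0 <= z n x.
Proof.
  intros Hx. unfold z.
  apply Rdiv_le_0_compat; [|apply INR_fact_lt_0].
  apply Rmult_le_pos; [left; apply exp_pos|now apply pow_le].
Qed.

Lemma z_S (n : nat) (x : R) : INR (S n) * z (S n) x = x * z n x.
Proof.
  unfold z. change (fact (S n)) with (S n * fact n)%nat.
  rewrite mult_INR, <- tech_pow_Rmult. field.
  split; [apply INR_fact_neq_0|now apply not_0_INR].
Qed.

Lemma is_series_eq (a b : nat -> R) (l : R) :
  (forall n, a n = b n) -> is_series a l -> is_series b l.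
Proof. exact (is_series_ext a b l). Qed.

Lemma is_exp_series (y : R) : is_series (fun n => y ^ n / INR (fact n)) (exp y).
Proof.
  apply is_series_eq with (2 := is_exp_Reals y); intros n.
  rewrite pow_n_pow. unfold scal; simpl; unfold mult; simpl. now field; apply INR_fact_neq_0.
Qed.

Lemma is_mean_ext (x : R) (f h : nat -> R) (v : R) :
  (forall n, f n = h n) -> is_mean x f v -> is_mean x h v.
Proof.
  intros H. apply is_series_eq. intros n. now rewrite H.
Qed.

Lemma is_mean_plus (x : R) (f h : nat -> R) (u v : R) :
  is_mean x f u -> is_mean x h v -> is_mean x (fun n => f n + h n) (u + v).
Proof.
  intros Hf Hh. apply is_series_eq with (2 := is_series_plus _ _ _ _ Hf Hh).
  intros n. unfold plus; simpl. ring.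
Qed.

Lemma is_mean_scal (x c : R) (f : nat -> R) (u : R) :
  is_mean x f u -> is_mean x (fun n => c * f n) (c * u).
Proof.
  intros Hf. apply is_series_eq with (2 := is_series_scal c _ _ Hf).
  intros n. unfold scal; simpl; unfold mult; simpl. ring.
Qed.

(** The Poisson probability generating function. *)
Lemma is_mean_pow (x t : R) : is_mean x (fun n => t ^ n) (exp (t * x - x)).
Proof.
  replace (exp (t * x - x)) with (exp (- x) * exp (t * x))
    by (rewrite <- exp_plus; f_equal; ring).
  apply is_series_eq with (2 := is_series_scal (exp (- x)) _ _ (is_exp_series (t * x))).
  intros n. unfold scal, z; simpl; unfold mult; simpl. rewrite Rpow_mult_distr. field.
  apply INR_fact_neq_0.
Qed.

Lemma is_mean_const (x c : R) : is_mean x (fun _ => c) c.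
Proof.
  pose proof (is_mean_scal x c _ _ (is_mean_pow x 1)) as H.
  replace (c * exp (1 * x - x)) with c in H
    by (replace (1 * x - x) with 0 by ring; rewrite exp_0; ring).
  apply is_mean_ext with (2 := H). intros n. rewrite pow1. ring.
Qed.

Lemma is_series_first (a : nat -> R) (l : R) :
  is_series (fun n => a (S n)) (l - a 0%nat) -> is_series a l.
Proof. exact (is_series_decr_1 a l). Qed.

Lemma is_series_tail (a : nat -> R) (l : R) :
  is_series a (l + a 0%nat) -> is_series (fun n => a (S n)) l.
Proof. exact (is_series_incr_1 a l). Qed.

Lemma is_series_at (k : nat) (a : nat -> R) :
  is_series (fun n => if Nat.eqb n k then a n else 0) (a k).
Proof.
  assert (H0 : is_series (fun _ : nat => 0) 0).
  { apply is_series_eq with (2 := is_mean_const 0 0). intros n. apply Rmult_0_r. }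
  revert a; induction k as [|k IH]; intros a; apply is_series_first; simpl.
  - now rewrite Rminus_diag.
  - rewrite Rminus_0_r. apply (IH (fun n => a (S n))).
Qed.

Lemma is_mean_dirac (x : R) (k : nat) : is_mean x (dirac k) (z k x).
Proof.
  apply is_series_eq with (2 := is_series_at k (fun n => z n x)).
  intros n. unfold dirac. destruct (Nat.eqb n k); ring.
Qed.

Lemma is_mean_le (x : R) (f h : nat -> R) (u v : R) :
  0 <= x -> (forall n, f n <= h n) -> is_mean x f u -> is_mean x h v -> u <= v.
Proof.
  intros Hx H Hf Hh.
  pose proof (is_mean_plus _ _ _ _ _ Hh (is_mean_scal _ (-1) _ _ Hf)) as Hd.
  cut (0 <= v + -1 * u); [lra|].
  assert (H0 := is_mean_const x 0).
  rewrite <- (is_series_unique _ _ Hd), <- (is_series_unique _ _ H0).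
  apply Series_le; [|now eexists; exact Hd].
  intros n. pose proof (z_ge0 n x Hx). pose proof (H n). nra.
Qed.

Lemma ex_mean_dominated (x : R) (f h : nat -> R) (v : R) :
  0 <= x -> (forall n, Rabs (f n) <= h n) -> is_mean x h v ->
  exists u, is_mean x f u.
Proof.
  intros Hx H Hh.
  apply (ex_series_le (fun n => z n x * f n) (fun n => z n x * h n)); [|now exists v].
  intros n. change (norm (z n x * f n)) with (Rabs (z n x * f n)).
  rewrite Rabs_mult, (Rabs_pos_eq (z n x)) by now apply z_ge0.
  apply Rmult_le_compat_l; [now apply z_ge0|apply H].
Qed.

Lemma is_mean_id (x : R) : is_mean x INR x.
Proof.
  apply is_series_first.
  replace (x - z 0 x * INR 0) with (x * 1) by (simpl; ring).
  apply is_series_eq with (2 := is_mean_scal x x _ _ (is_mean_const x 1)).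
  intros n.
  rewrite (Rmult_comm _ (INR _)), z_S. ring.
Qed.

(** Dividing by [n + 1] turns [n!] into [(n + 1)!]: what remains is the exponential series at
    [t * x] without its constant term, over [t * x]. *)
Lemma is_mean_pow_div (x t : R) : 0 < t * x ->
  is_mean x (fun n => t ^ n / INR (S n)) (exp (- x) * ((exp (t * x) - 1) / (t * x))).
Proof.
  intros Hy. set (y := t * x) in *.
  assert (H : is_series (fun n => y ^ S n / INR (fact (S n))) (exp y - 1)).
  { apply (is_series_tail (fun n => y ^ n / INR (fact n))).
    replace (exp y - 1 + y ^ 0 / INR (fact 0)) with (exp y) by (simpl; field).
    apply is_exp_series. }
  replace (exp (- x) * ((exp y - 1) / y)) with (exp (- x) / y * (exp y - 1)) by (field; lra).
  apply is_series_eq with (2 := is_series_scal (exp (- x) / y) _ _ H).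
  intros n. change (scal (exp (- x) / y) (y ^ S n / INR (fact (S n))))
    with (exp (- x) / y * (y ^ S n / INR (fact (S n)))).
  change (fact (S n)) with (S n * fact n)%nat. unfold z.
  rewrite mult_INR, <- tech_pow_Rmult.
  replace (y ^ n) with (t ^ n * x ^ n) by (unfold y; symmetry; apply Rpow_mult_distr).
  unfold y. field.
  repeat split; try apply INR_fact_neq_0; try now apply not_0_INR.
  all: intros ->; unfold y in Hy; lra.
Qed.

(** * Payoffs at a store *)

(* Payoffs against [n] rivals net of the reserve-price term, which only occurs
   for [n = 0]. *)
Definition high_rent (b t : R) (n : nat) : R :=
  match n with 0%nat => 0 | _ => Rmax (t ^ n - b) 0 end.

Definition low_rent (b t : R) (n : nat) : R :=
  match n with 0%nat => 0 | _ => Rmax (t ^ n / INR (S n) - b) 0 end.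

Lemma payoff_all_pay (b r t : R) (n : nat) :
  buyer_payoff b high (Posting all_pay r) t (S n) = (1 - r) * dirac 0 n + high_rent b t n /\
  buyer_payoff b low (Posting all_pay r) t (S n) = (1 - r) * dirac 0 n + low_rent b t n.
Proof.
  unfold dirac, high_rent, low_rent. destruct n; cbn -[pow INR]; split; ring.
Qed.

(** At [n = 0] the formulas for contested stores would give [1 - b], as [t ^ 0 = 1]; the [dirac]
    term corrects this to [1 - r]. *)
Lemma payoff_standard (b r t : R) (n : nat) :
  buyer_payoff b high (Posting standard r) t (S n) =
    (1 - r - (1 - b)) * dirac 0 n + (1 - b) * t ^ n /\
  buyer_payoff b low (Posting standard r) t (S n) =
    (1 - r - (1 - b)) * dirac 0 n + (1 - b) * (t ^ n / INR (S n)).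
Proof.
  unfold dirac. destruct n; cbn -[pow INR]; simpl pow; split; try ring.
  simpl INR. field.
Qed.

Lemma theta_bounds (xh xl : R) : 0 <= xh -> 0 <= xl -> 0 <= theta xh xl <= 1.
Proof.
  intros Hh Hl. unfold theta. destruct (Req_dec (xh + xl) 0) as [H|H].
  (* The numerator vanishes as well, and [0 * / 0] is [0]. *)
  - assert (xl = 0) by lra. subst xl. unfold Rdiv. lra.
  - split; [apply Rdiv_le_0_compat; lra|].
    apply Rmult_le_reg_r with (xh + xl); [lra|]. unfold Rdiv.
    rewrite Rmult_assoc, Rinv_l; lra.
Qed.

Lemma theta_mul (xh xl : R) : 0 <= xh -> 0 <= xl -> theta xh xl * (xh + xl) = xl.
Proof.
  intros Hh Hl. unfold theta. destruct (Req_dec (xh + xl) 0) as [H|H].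
  - rewrite H. lra.
  - now field.
Qed.

Lemma pow_unit_interval (t : R) (n : nat) : 0 <= t <= 1 -> 0 <= t ^ n <= 1.
Proof.
  intros Ht. split; [now apply pow_le|]. rewrite <- (pow1 n). now apply pow_incr.
Qed.

Lemma div_S_unit_interval (u : R) (n : nat) : 0 <= u <= 1 -> 0 <= u / INR (S n) <= u.
Proof.
  intros Hu. assert (H : 1 <= INR (S n)) by (rewrite S_INR; pose proof (pos_INR n); lra).
  split; [apply Rdiv_le_0_compat; lra|].
  apply Rmult_le_reg_r with (INR (S n)); [lra|]. unfold Rdiv.
  rewrite Rmult_assoc, Rinv_l; nra.
Qed.

Lemma buyer_payoff_bounds (b r t : R) (m : format) (i : buyer_type) (n : nat) :
  0 < b < 1 -> 0 <= r <= 1 -> 0 <= t <= 1 ->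
  0 <= buyer_payoff b i (Posting m r) t (S n) <= 1.
Proof.
  intros Hb Hr Ht. pose proof (pow_unit_interval t n Ht) as Hp.
  pose proof (div_S_unit_interval _ n Hp) as Hd.
  destruct n as [|n]; [simpl; lra|].
  unfold buyer_payoff. cbn [fmt]. replace (S (S n) - 1)%nat with (S n) by lia.
  destruct m, i.
  1,2: nra.
  all: split; [apply Rmax_r|apply Rmax_lub; lra].
Qed.

(** Payoffs lie in [0, 1], so the series in [U] converges and [U] is a genuine expectation. *)
Lemma mean_U (b : R) (i : buyer_type) (p : posting) (xh xl : R) :
  0 < b < 1 -> 0 <= reserve p <= 1 -> 0 <= xh -> 0 <= xl ->
  is_mean (xh + xl) (fun n => buyer_payoff b i p (theta xh xl) (S n)) (U b i p xh xl).
Proof.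
  intros Hb Hr Hh Hl. destruct p as [m r].
  destruct (ex_mean_dominated (xh + xl)
    (fun n => buyer_payoff b i (Posting m r) (theta xh xl) (S n)) (fun _ => 1) 1) as [v Hv].
  - lra.
  - intros n. rewrite Rabs_pos_eq; apply buyer_payoff_bounds; auto using theta_bounds.
  - apply is_mean_const.
  - unfold U. rewrite (is_series_unique _ _ Hv). exact Hv.
Qed.

Lemma seller_payoff_surplus (b t : R) (p : posting) (n : nat) :
  seller_payoff b p t (S n) =
    1 - INR (S n) * (1 - t) * buyer_payoff b high p t (S n)
      - INR (S n) * t * buyer_payoff b low p t (S n).
Proof.
  destruct p as [m r]. destruct n as [|n]; [simpl; ring|].
  destruct m; [|reflexivity].
  unfold seller_payoff, buyer_payoff. cbn [fmt].
  replace (S (S n) - 1)%nat with (S n) by lia.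
  rewrite <- (tech_pow_Rmult t (S n)). field. now apply not_0_INR.
Qed.

(** Sums the per-store split of the surplus. By [z_S], the weight of [n + 1] customers times their
    number is [x] times the weight of [n] rivals, which gives arrival rate times utility. *)
Lemma Pi_surplus (b : R) (p : posting) (xh xl : R) :
  0 < b < 1 -> 0 <= reserve p <= 1 -> 0 <= xh -> 0 <= xl ->
  Pi b p xh xl =
    1 - exp (- (xh + xl)) - xh * U b high p xh xl - xl * U b low p xh xl.
Proof.
  intros Hb Hr Hh Hl. set (x := xh + xl).
  pose proof (mean_U b high p xh xl Hb Hr Hh Hl) as Uh.
  pose proof (mean_U b low p xh xl Hb Hr Hh Hl) as Ul. fold x in Uh, Ul.
  set (t := theta xh xl) in *.
  assert (Htx : t * x = xl) by now apply theta_mul.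
  assert (Hone : is_series (fun n => z (S n) x) (1 - exp (- x))).
  { apply (is_series_tail (fun n => z n x)).
    replace (1 - exp (- x) + z 0 x) with 1 by (unfold z; simpl; field).
    apply is_series_eq with (2 := is_mean_const x 1). intros n. ring. }
  apply is_series_unique.
  pose proof (is_series_plus _ _ _ _ Hone
    (is_mean_plus _ _ _ _ _ (is_mean_scal _ (- xh) _ _ Uh) (is_mean_scal _ (- xl) _ _ Ul))) as H.
  replace (1 - exp (- x) - xh * U b high p xh xl - xl * U b low p xh xl)
    with (1 - exp (- x) + (- xh * U b high p xh xl + - xl * U b low p xh xl)) by ring.
  apply is_series_eq with (2 := H). intros n. fold t x. rewrite seller_payoff_surplus.
  set (uh := buyer_payoff b high p t (S n)). set (ul := buyer_payoff b low p t (S n)).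
  transitivity (z (S n) x - (INR (S n) * z (S n) x) * ((1 - t) * uh + t * ul)); [|ring].
  rewrite z_S.
  replace (- xh) with (- (x - xl)) by (unfold x; ring). rewrite <- Htx.
  change (z (S n) x + z n x * (- (x - t * x) * uh + - (t * x) * ul) =
    z (S n) x - x * z n x * ((1 - t) * uh + t * ul)). ring.
Qed.

Lemma U_standard (b r xh xl : R) :
  0 <= xh -> 0 < xl ->
  let x := xh + xl in
  U b high (Posting standard r) xh xl =
    exp (- x) * (1 - r + (1 - b) * (exp xl - 1)) /\
  U b low (Posting standard r) xh xl =
    exp (- x) * (1 - r + (1 - b) * ((exp xl - 1) / xl - 1)).
Proof.
  intros Hh Hl x. set (t := theta xh xl).
  assert (Htx : t * x = xl) by (apply theta_mul; lra).
  pose proof (is_mean_dirac x 0) as H0.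
  replace (z 0 x) with (exp (- x)) in H0 by (unfold z; simpl; field).
  pose proof (is_mean_pow x t) as Hp.
  assert (Hd : 0 < t * x) by lra. apply is_mean_pow_div in Hd. rewrite Htx in *.
  split; apply is_series_unique; fold x t.
  - replace (exp (- x) * (1 - r + (1 - b) * (exp xl - 1)))
      with ((1 - r - (1 - b)) * exp (- x) + (1 - b) * exp (xl - x)).
    + refine (is_mean_ext _ _ _ _ _ (is_mean_plus _ _ _ _ _
        (is_mean_scal _ _ _ _ H0) (is_mean_scal _ _ _ _ Hp))).
      intros n. symmetry. apply payoff_standard.
    + replace (xl - x) with (xl + - x) by ring. rewrite exp_plus. ring.
  - replace (exp (- x) * (1 - r + (1 - b) * ((exp xl - 1) / xl - 1)))
      with ((1 - r - (1 - b)) * exp (- x) + (1 - b) * (exp (- x) * ((exp xl - 1) / xl))) by ring.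
    refine (is_mean_ext _ _ _ _ _ (is_mean_plus _ _ _ _ _
        (is_mean_scal _ _ _ _ H0) (is_mean_scal _ _ _ _ Hd))).
    intros n. symmetry. apply payoff_standard.
Qed.

Lemma U_all_pay (b r xh xl ph pl : R) :
  is_mean (xh + xl) (high_rent b (theta xh xl)) ph ->
  is_mean (xh + xl) (low_rent b (theta xh xl)) pl ->
  U b high (Posting all_pay r) xh xl = exp (- (xh + xl)) * (1 - r) + ph /\
  U b low (Posting all_pay r) xh xl = exp (- (xh + xl)) * (1 - r) + pl.
Proof.
  intros Hh Hl. pose proof (is_mean_dirac (xh + xl) 0) as H0.
  replace (z 0 (xh + xl)) with (exp (- (xh + xl))) in H0 by (unfold z; simpl; field).
  rewrite (Rmult_comm (exp _)).
  split; apply is_series_unique.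
  - refine (is_mean_ext _ _ _ _ _ (is_mean_plus _ _ _ _ _ (is_mean_scal _ _ _ _ H0) Hh)).
    intros n. symmetry. apply payoff_all_pay.
  - refine (is_mean_ext _ _ _ _ _ (is_mean_plus _ _ _ _ _ (is_mean_scal _ _ _ _ H0) Hl)).
    intros n. symmetry. apply payoff_all_pay.
Qed.

(** For [n >= 1] rivals, [theta ^ n <= theta <= b] truncates every rent to 0; only a lone buyer,
    with probability [exp (- x)], keeps [1 - r]. *)
Lemma U_all_pay_few_low (b r xh xl : R) (i : buyer_type) :
  0 <= xh -> 0 <= xl -> theta xh xl <= b -> b <= 1 ->
  U b i (Posting all_pay r) xh xl = exp (- (xh + xl)) * (1 - r).
Proof.
  intros Hh Hl Ht Hb. pose proof (theta_bounds _ _ Hh Hl) as Ht0.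
  assert (Hp : forall n, theta xh xl ^ S n <= b).
  { intros n. pose proof (pow_unit_interval _ n Ht0). simpl. nra. }
  assert (H0 : forall f : nat -> R, (forall n, f n = 0) -> is_mean (xh + xl) f 0).
  { intros f Hf. apply is_mean_ext with (2 := is_mean_const _ 0). now intros n; rewrite Hf. }
  assert (Hrents : forall n, high_rent b (theta xh xl) n = 0 /\ low_rent b (theta xh xl) n = 0).
  { intros [|n]; [now split|]. pose proof (Hp n).
    pose proof (div_S_unit_interval _ (S n) (pow_unit_interval _ (S n) Ht0)).
    unfold high_rent, low_rent. rewrite !Rmax_right; lra. }
  destruct (U_all_pay b r xh xl 0 0) as [Uh Ul].
  - apply H0. apply Hrents.
  - apply H0. apply Hrents.
  - destruct i; [rewrite Uh|rewrite Ul]; ring.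
Qed.

(** * Rents in the all-pay format *)

(** The reserve price enters both types' payoffs equally, so the mean of this gap is the difference
    of their utilities whatever the reserve. *)
Definition rent_gap (b t : R) (n : nat) : R := high_rent b t n - low_rent b t n.

Lemma low_rent_bounds (b t : R) (n : nat) :
  0 < b -> 0 <= t <= 1 -> 0 <= low_rent b t n <= 1.
Proof.
  intros Hb Ht. destruct n as [|n]; [simpl; lra|]. unfold low_rent.
  pose proof (pow_unit_interval t (S n) Ht) as Hp.
  pose proof (div_S_unit_interval _ (S n) Hp).
  split; [apply Rmax_r|apply Rmax_lub; lra].
Qed.

Lemma Rmax_0_lipschitz (u v : R) : Rabs (Rmax u 0 - Rmax v 0) <= Rabs (u - v).
Proof.
  unfold Rmax. destruct (Rle_dec u 0), (Rle_dec v 0); unfold Rabs;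
    repeat destruct Rcase_abs; lra.
Qed.

Lemma pow_lipschitz (s t : R) (n : nat) : 0 <= s <= 1 -> 0 <= t <= 1 ->
  Rabs (s ^ n - t ^ n) <= INR n * Rabs (s - t).
Proof.
  intros Hs Ht. induction n as [|n IH].
  - simpl. rewrite Rminus_diag, Rabs_R0. lra.
  - rewrite S_INR, <- !tech_pow_Rmult.
    replace (s * s ^ n - t * t ^ n) with (s * (s ^ n - t ^ n) + (s - t) * t ^ n) by ring.
    eapply Rle_trans; [apply Rabs_triang|]. rewrite !Rabs_mult.
    pose proof (pow_unit_interval t n Ht) as Hp.
    rewrite (Rabs_pos_eq s), (Rabs_pos_eq (t ^ n)) by lra.
    pose proof (Rabs_pos (s - t)). pose proof (Rabs_pos (s ^ n - t ^ n)). nra.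
Qed.

(** Truncation at 0 and division by [n + 1] do not increase distances, so each rent inherits the
    constant [n] of [t ^ n]. A bound linear in [n] has a finite Poisson mean. *)
Lemma rent_gap_lipschitz (b s t : R) (n : nat) : 0 <= s <= 1 -> 0 <= t <= 1 ->
  Rabs (rent_gap b s n - rent_gap b t n) <= 2 * Rabs (s - t) * INR n.
Proof.
  intros Hs Ht. destruct n as [|n].
  { unfold rent_gap; simpl. rewrite !Rminus_diag, Rabs_R0. lra. }
  pose proof (pow_lipschitz s t (S n) Hs Ht) as Hp.
  unfold rent_gap, high_rent, low_rent.
  set (k := INR (S (S n))).
  assert (Hk : 1 <= k) by (unfold k; rewrite !S_INR; pose proof (pos_INR n); lra).
  pose proof (Rmax_0_lipschitz (s ^ S n - b) (t ^ S n - b)) as H1.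
  pose proof (Rmax_0_lipschitz (s ^ S n / k - b) (t ^ S n / k - b)) as H2.
  replace (s ^ S n - b - (t ^ S n - b)) with (s ^ S n - t ^ S n) in H1 by ring.
  replace (s ^ S n / k - b - (t ^ S n / k - b)) with ((s ^ S n - t ^ S n) * / k) in H2
    by (field; lra).
  rewrite Rabs_mult, (Rabs_pos_eq (/ k)) in H2 by (left; apply Rinv_0_lt_compat; lra).
  assert (Hk' : / k <= 1) by (rewrite <- Rinv_1; apply Rinv_le_contravar; lra).
  pose proof (Rabs_pos (s ^ S n - t ^ S n)).
  assert (H3 : Rabs (s ^ S n - t ^ S n) * / k <= Rabs (s ^ S n - t ^ S n)) by nra.
  set (A := Rmax (s ^ S n - b) 0) in *. set (B := Rmax (t ^ S n - b) 0) in *.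
  set (C := Rmax (s ^ S n / k - b) 0) in *. set (D := Rmax (t ^ S n / k - b) 0) in *.
  replace (A - C - (B - D)) with ((A - B) + - (C - D)) by ring.
  eapply Rle_trans; [apply Rabs_triang|]. rewrite Rabs_Ropp. lra.
Qed.

Lemma rent_gap_at_budget (b : R) (n : nat) : 0 < b < 1 -> rent_gap b b n = 0.
Proof.
  intros Hb. destruct n as [|n]; unfold rent_gap; simpl; [ring|].
  pose proof (pow_unit_interval b n ltac:(lra)) as Hp.
  assert (Hp' : b * b ^ n <= b) by nra.
  pose proof (div_S_unit_interval (b * b ^ n) (S n) ltac:(nra)) as Hd. simpl in Hd.
  rewrite !Rmax_right; lra.
Qed.

(** Against a rival the high rent is [1 - b] and the low rent at most [Rmax (1 / 2 - b) 0]; their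
    difference is the [Rmin]. *)
Lemma rent_gap_at_one (b : R) (n : nat) : 0 < b < 1 ->
  Rmin (1 / 2) (1 - b) * (1 - dirac 0 n) <= rent_gap b 1 n.
Proof.
  intros Hb. destruct n as [|n].
  { unfold rent_gap, dirac; simpl. lra. }
  unfold rent_gap, high_rent, low_rent, dirac. cbn [Nat.eqb]. rewrite pow1.
  assert (Hk : 1 / INR (S (S n)) <= 1 / 2).
  { unfold Rdiv. rewrite !Rmult_1_l. apply Rinv_le_contravar; [lra|].
    rewrite !S_INR. pose proof (pos_INR n). lra. }
  rewrite (Rmax_left (1 - b)) by lra.
  unfold Rmin, Rmax. destruct Rle_dec, Rle_dec; lra.
Qed.

(** With [n >= 1] rivals a low type wins at most a value [t / 2 <= b]. *)
Lemma low_rent_few_low (b t : R) (n : nat) :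
  0 < b -> 0 <= t <= 1 -> t <= 2 * b -> low_rent b t n = 0.
Proof.
  intros Hb Ht Htb. destruct n as [|n]; [reflexivity|]. unfold low_rent. apply Rmax_right.
  pose proof (pow_unit_interval t n Ht) as Hp.
  assert (Hk : 2 <= INR (S (S n))) by (rewrite !S_INR; pose proof (pos_INR n); lra).
  assert (t ^ S n / INR (S (S n)) <= b); [|lra].
  apply Rmult_le_reg_r with (INR (S (S n))); [lra|].
  unfold Rdiv. rewrite Rmult_assoc, Rinv_l, <- tech_pow_Rmult; nra.
Qed.

(** Against one rival the gap is [t / 2] and the low rent [t / 2 - b], hence the extra [b]; against
    more, twice the low rent is at most the high rent. *)
Lemma low_rent_many_low (b t : R) (n : nat) :
  0 < b -> 0 <= t <= 1 -> 2 * b < t -> low_rent b t n + b * dirac 1 n <= rent_gap b t n.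
Proof.
  intros Hb Ht Htb. unfold rent_gap.
  destruct n as [|[|n]]; unfold high_rent, low_rent, dirac; cbn [Nat.eqb].
  - lra.
  - simpl. rewrite !Rmax_left; lra.
  - set (u := t ^ S (S n)). set (k := INR (S (S (S n)))).
    assert (Hk : 2 <= k) by (unfold k; rewrite !S_INR; pose proof (pos_INR n); lra).
    assert (Hu : 0 <= u) by (apply pow_unit_interval; lra).
    assert (Hd : u / k <= u / 2).
    { apply Rmult_le_compat_l; [lra|]. apply Rinv_le_contravar; lra. }
    unfold Rmax. repeat destruct Rle_dec; lra.
Qed.

(** Extends functions of a share in [0, 1] to the whole line, since [IVT_gen] asks for continuity
    everywhere. *)
Definition clamp (t : R) : R := Rmax 0 (Rmin t 1).

Lemma clamp_bounds (t : R) : 0 <= clamp t <= 1.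
Proof. unfold clamp, Rmax, Rmin. repeat destruct Rle_dec; lra. Qed.

Lemma clamp_id (t : R) : 0 <= t <= 1 -> clamp t = t.
Proof. intros Ht. unfold clamp, Rmax, Rmin. repeat destruct Rle_dec; lra. Qed.

Lemma clamp_lipschitz (s t : R) : Rabs (clamp s - clamp t) <= Rabs (s - t).
Proof.
  unfold clamp, Rmax, Rmin. repeat destruct Rle_dec; unfold Rabs;
    repeat destruct Rcase_abs; lra.
Qed.

Lemma ex_mean_low_rent (b t x : R) : 0 < b -> 0 <= t <= 1 -> 0 <= x ->
  exists v, is_mean x (low_rent b t) v.
Proof.
  intros Hb Ht Hx. apply ex_mean_dominated with (fun _ => 1) 1; auto using is_mean_const.
  intros n. pose proof (low_rent_bounds b t n Hb Ht). rewrite Rabs_pos_eq; lra.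
Qed.

Lemma ex_mean_rent_gap (b t x : R) : 0 < b < 1 -> 0 <= t <= 1 -> 0 <= x ->
  exists v, is_mean x (rent_gap b t) v.
Proof.
  intros Hb Ht Hx.
  apply ex_mean_dominated with (fun n => 2 * Rabs (t - b) * INR n) (2 * Rabs (t - b) * x);
    auto using is_mean_scal, is_mean_id.
  (* Subtracting the zero gap at [b] turns the Lipschitz estimate into a bound. *)
  intros n. rewrite <- (Rminus_0_r (rent_gap b t n)), <- (rent_gap_at_budget b n Hb).
  apply rent_gap_lipschitz; lra.
Qed.

(** Intermediate values in [t]: the mean gap is 0 at [b], at least the given bound at 1, and
    Lipschitz with constant [2 * x]. *)
Lemma rent_gap_attained (b x v : R) :
  0 < b < 1 -> 0 <= x -> 0 <= v <= Rmin (1 / 2) (1 - b) * (1 - exp (- x)) ->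
  exists t, b <= t <= 1 /\ is_mean x (rent_gap b t) v.
Proof.
  intros Hb Hx Hv.
  set (F := fun t => Series (fun n => z n x * rent_gap b (clamp t) n)).
  assert (HF : forall t, is_mean x (rent_gap b (clamp t)) (F t)).
  { intros t. destruct (ex_mean_rent_gap b (clamp t) x) as [w Hw]; auto using clamp_bounds.
    unfold F. rewrite (is_series_unique _ _ Hw). exact Hw. }
  assert (Hlip : forall s t, F s - F t <= 2 * x * Rabs (s - t)).
  { intros s t.
    pose proof (is_mean_plus _ _ _ _ _ (HF s) (is_mean_scal _ (-1) _ _ (HF t))) as H1.
    pose proof (is_mean_scal _ (2 * Rabs (s - t)) _ _ (is_mean_id x)) as H2.
    pose proof (fun H => is_mean_le x _ _ _ _ Hx H H1 H2) as H3. cbv beta in H3.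
    cut (F s + -1 * F t <= 2 * Rabs (s - t) * x); [lra|]. apply H3. intros n.
    pose proof (rent_gap_lipschitz b _ _ n (clamp_bounds s) (clamp_bounds t)) as H4.
    pose proof (clamp_lipschitz s t). pose proof (pos_INR n).
    pose proof (Rle_abs (rent_gap b (clamp s) n - rent_gap b (clamp t) n)). nra. }
  assert (Fb : F b = 0).
  { apply is_series_unique. apply is_mean_ext with (2 := is_mean_const x 0).
    intros n. rewrite clamp_id by lra. symmetry. now apply rent_gap_at_budget. }
  assert (F1 : v <= F 1).
  { apply Rle_trans with (1 := proj2 Hv).
    pose proof (is_mean_scal _ (Rmin (1 / 2) (1 - b)) _ _ (is_mean_plus _ _ _ _ _
      (is_mean_const x 1) (is_mean_scal _ (-1) _ _ (is_mean_dirac x 0)))) as H.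
    replace (1 - exp (- x)) with (1 + -1 * z 0 x) by (unfold z; simpl; field).
    refine (is_mean_le x _ _ _ _ Hx _ H (HF 1)). intros n.
    rewrite clamp_id by lra.
    replace (1 + -1 * dirac 0 n) with (1 - dirac 0 n) by ring. now apply rent_gap_at_one. }
  destruct (IVT_gen F b 1 v) as [t [Ht Hvt]].
  (* The [+ 1] keeps the denominator positive at [x = 0]. *)
  - intros t0 eps Heps. exists (eps / (2 * x + 1)). split.
    + apply Rdiv_lt_0_compat; lra.
    + intros t [_ Ht]. simpl in *. unfold Rdist in *.
      assert (H : 2 * x * Rabs (t - t0) < eps).
      { apply Rle_lt_trans with ((2 * x + 1) * Rabs (t - t0)).
        - pose proof (Rabs_pos (t - t0)). nra.
        - apply Rmult_lt_compat_l with (r := 2 * x + 1) in Ht; [|lra].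
          replace ((2 * x + 1) * (eps / (2 * x + 1))) with eps in Ht by (field; lra). lra. }
      pose proof (Hlip t t0). pose proof (Hlip t0 t) as H'.
      rewrite Rabs_minus_sym in H'. apply Rabs_def1; lra.
  - rewrite Fb, Rmin_left, Rmax_right; lra.
  - rewrite Rmin_left, Rmax_right in Ht by lra. exists t. split; [lra|].
    rewrite <- Hvt. pose proof (HF t) as H. now rewrite clamp_id in H by lra.
Qed.

(** * Choice of the deviation *)

Lemma exp_ge_quartic (y : R) : 0 <= y ->
  1 + y + y * y / 2 + y * y * y / 6 + y * y * y * y / 24 <= exp y.
Proof.
  intros Hy. eapply Rle_trans; [|apply (exp_ge_taylor y 4 Hy)].
  cbn -[INR]. rewrite !INR_IZR_INZ. cbn. right. field.
Qed.

Lemma ln_le_of_le_exp (m y : R) : 0 < m -> m <= exp y -> ln m <= y.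
Proof.
  intros Hm H. rewrite <- (ln_exp y). apply ln_le; lra.
Qed.

(* For [y = sigma * lambda], utilities at a symmetric standard equilibrium are
   [exp lambda * Omega_l = N] and [exp lambda * Omega_h = N + q * g]. The
   deviator aims at the total rate [lambda - ln m]. The condition on
   [exp lambda - m] makes the gap between the two types' rents attainable, the one
   for [b < 1 / 2] keeps his reserve price at most 1, [N <= m] keeps it
   nonnegative, and the last one makes the deviation profitable. The choice is
   [m = max 1 N] for [y <= 2] or [b >= 1 / 2], and [m = 2 * N] otherwise. *)
Lemma exists_multiplier (lambda sigma b r : R) :
  0 < lambda -> 0 < sigma < 1 -> 0 < b < 1 -> sigma < b -> 0 <= r <= 1 ->
  let y := sigma * lambda in
  let h := (exp y - 1) / y - 1 in
  let g := exp y - 1 - h in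
  let q := 1 - b in
  let N := 1 - r + q * h in
  exists m,
    1 <= m /\ 0 <= N <= m /\
    m < exp lambda /\
    0 < g /\
    q * g <= Rmin (1 / 2) q * (exp lambda - m) /\
    (b < 1 / 2 -> q * g - m * (b * (lambda - ln m)) <= N) /\
    0 <= 1 - m + (N + q * q * g) * ln m.
Proof.
  intros Hlambda Hsigma Hb Hsb Hr y h g q N.
  assert (Hy : 0 < y) by (unfold y; nra).
  assert (Hyb : y < b * lambda) by (unfold y; nra).
  assert (Hyl : y < lambda) by nra.
  pose proof (exp_ge_quartic y ltac:(lra)) as HE.
  assert (Hhy : h * y = exp y - 1 - y) by (unfold h; field; lra).
  assert (Hg : g = h * (y - 1) + y) by (unfold g; lra).
  assert (Hgh : g + h = exp y - 1) by (unfold g; lra).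
  assert (Hh : y / 2 + y * y / 6 + y * y * y / 24 <= h).
  { apply Rmult_le_reg_r with y; [lra|]. nra. }
  assert (Hhy2 : y / 2 <= h).
  { assert (0 <= y * y * y) by (repeat apply Rmult_le_pos; lra). nra. }
  assert (HEy : 1 + h < exp y).
  { (* [1 - / exp y < y], multiplied by [exp y] *)
    assert (Hn : 1 + - y < exp (- y)) by (apply exp_ineq1; lra).
    rewrite exp_Ropp in Hn. pose proof (exp_pos y) as Hp.
    apply Rmult_lt_reg_r with y; [lra|].
    apply Rmult_lt_compat_r with (r := exp y) in Hn; [|lra].
    rewrite Rinv_l in Hn by lra. nra. }
  assert (Hgpos : 0 < g) by (unfold g; lra).
  assert (Hh0 : 0 < h) by nra.
  assert (HN : q * h <= N <= 1 + q * h) by (unfold N; lra).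
  assert (Hqb : q = 1 - b) by reflexivity.
  clearbody N q g h y.
  assert (Hq : 0 < q < 1) by lra.
  assert (Hqh : 0 <= q * h <= h) by nra.
  assert (Hqg : q * g <= g) by nra.
  assert (HN0 : 0 <= N) by lra.
  assert (HN' : N < exp y) by lra.
  assert (Hexp : exp y < exp lambda) by now apply exp_increasing.
  (* If [q <= 1 / 2], then [exp lambda - m >= exp y - 1 - h = g]. Otherwise [b < 1 / 2] gives
     [lambda > 2 * y], so [exp lambda] exceeds the square of [exp y]. *)
  assert (Hcap : forall m, m <= exp y -> (q <= 1 / 2 -> m <= 1 + h) ->
    q * g <= Rmin (1 / 2) q * (exp lambda - m)).
  { intros m Hm1 Hm2. destruct (Rle_dec q (1 / 2)) as [Hq2|Hq2].
    - rewrite Rmin_right by lra. specialize (Hm2 Hq2). apply Rmult_le_compat_l; lra.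
    - rewrite Rmin_left by lra.
      assert (HE2 : exp y * exp y <= exp lambda).
      { rewrite <- exp_plus. left. apply exp_increasing.
        clear - Hyb Hlambda Hqb Hq2. nra. }
      assert (Hn : 1 + - y < exp (- y)) by (apply exp_ineq1; lra).
      rewrite exp_Ropp in Hn. pose proof (exp_pos y) as Hp.
      apply Rmult_lt_compat_r with (r := exp y) in Hn; [|lra].
      rewrite Rinv_l in Hn by lra.
      assert (H1 : 0 <= exp y - 1) by lra.
      (* After multiplication by [exp y] and use of [Hn], the inequality reduces to this cube. *)
      assert (H3 : 0 <= (exp y - 1) * (exp y - 1) * (exp y - 1))
        by (apply Rmult_le_pos; [apply Rmult_le_pos|]; exact H1).
      assert (2 * exp y - 2 - y <= exp y * exp y - exp y); [|lra].
      apply Rmult_le_reg_r with (exp y); lra. }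
  assert (Hprofit : 1 <= N -> 0 <= 1 - N + (N + q * q * g) * ln N).
  { intros HN1.
    assert (H1 : 1 - / N <= ln N).
    { pose proof (exp_ineq1_le (- ln N)) as H. rewrite exp_Ropp, exp_ln in H; lra. }
    assert (H2 : N - 1 <= N * ln N).
    { replace (N - 1) with (N * (1 - / N)) by (field; lra). apply Rmult_le_compat_l; lra. }
    assert (H3 : 0 <= ln N) by (rewrite <- ln_1; apply ln_le; lra).
    assert (0 <= q * q * g * ln N) by (repeat apply Rmult_le_pos; lra).
    lra. }
  destruct (Rle_dec y 2) as [Hy2|Hy2]; [|destruct (Rle_dec (1 / 2) b) as [Hb2|Hb2]].
  - assert (Hgap : g - h <= y) by nra.
    assert (Hg2 : g <= h * (1 + y / 2)).
    { assert (y <= h * (2 - y / 2)); [|lra].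
      assert ((y / 2 + y * y / 6 + y * y * y / 24) * (2 - y / 2) <= h * (2 - y / 2))
        by (apply Rmult_le_compat_r; lra).
      (* The product on the left exceeds [y] by [y^2 * (4 - y^2) / 48]. *)
      assert (0 <= y * y * ((2 - y) * (2 + y)))
        by (apply Rmult_le_pos; [|apply Rmult_le_pos]; nra).
      lra. }
    destruct (Rle_dec N 1) as [HN1|HN1].
    + exists 1. rewrite ln_1.
      refine (conj _ (conj _ (conj _ (conj _ (conj _ (conj _ _)))))); try lra.
      * apply Hcap; lra.
      * intros _. assert (q * (g - h) <= q * y <= y) by (clear - Hgap Hq Hy; nra). lra.
    + exists N. refine (conj _ (conj _ (conj _ (conj _ (conj _ (conj _ _)))))); try lra.
      * apply Hcap; lra.
      * intros Hb2.
        assert (HlnN : ln N <= y) by (apply ln_le_of_le_exp; lra).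
        assert (0 <= ln N) by (rewrite <- ln_1; apply ln_le; lra).
        assert (q * g <= q * (h * (1 + y / 2))) by (apply Rmult_le_compat_l; lra).
        assert (q * h * (1 + y / 2) <= N * (1 + y / 2)) by (apply Rmult_le_compat_r; lra).
        assert (b * ln N <= y / 2) by nra.
        assert (N * (y / 2) <= N * (b * (lambda - ln N))) by (apply Rmult_le_compat_l; lra).
        lra.
  - destruct (Rle_dec N 1) as [HN1|HN1].
    + exists 1. rewrite ln_1.
      refine (conj _ (conj _ (conj _ (conj _ (conj _ (conj _ _)))))); try lra.
      apply Hcap; lra.
    + exists N. refine (conj _ (conj _ (conj _ (conj _ (conj _ (conj _ _)))))); try lra.
      apply Hcap; lra.
  - assert (Hyh : y <= h).
    { apply Rle_trans with (2 := Hh). clear - Hy2. nra. }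
    assert (Hq2 : 1 / 2 < q) by lra.
    assert (HN1 : 1 <= N) by (clear - HN Hq2 Hyh Hy2; nra).
    assert (Hm : 2 * N <= exp y).
    { assert (2 * h <= h * y) by (clear - Hh0 Hy2; nra). lra. }
    assert (Hln : ln (2 * N) <= y) by (apply ln_le_of_le_exp; lra).
    exists (2 * N). refine (conj _ (conj _ (conj _ (conj _ (conj _ (conj _ _)))))); try lra.
    + apply Hcap; lra.
    + intros _.
      assert (q * g <= q * (h * y)) by (apply Rmult_le_compat_l; lra).
      assert (q * h * y <= N * y) by (apply Rmult_le_compat_r; lra).
      assert (0 <= ln (2 * N)) by (rewrite <- ln_1; apply ln_le; lra).
      assert (b * ln (2 * N) <= y / 2) by nra.
      assert (2 * N * (y / 2) <= 2 * N * (b * (lambda - ln (2 * N))))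
        by (apply Rmult_le_compat_l; lra).
      lra.
    + (* [ln m = 2 ln s >= 2 (1 - 1/s)] for [m = s^2] *)
      set (s := sqrt (2 * N)).
      assert (Hs2 : s * s = 2 * N) by (apply sqrt_sqrt; lra).
      assert (Hs0 : 0 <= s) by apply sqrt_pos.
      assert (Hs1 : 1 < s) by (clear - HN1 Hs2 Hs0; nra).
      assert (Hlns : 1 - / s <= ln s).
      { pose proof (exp_ineq1_le (- ln s)) as H. rewrite exp_Ropp, exp_ln in H; lra. }
      rewrite <- Hs2, ln_mult by lra.
      assert (Hgh2 : h + 2 <= g) by (clear - Hg Hh0 Hy2 Hyh; nra).
      set (a := 2 * (q * q * g)).
      assert (Ha : 0 <= a) by (unfold a; repeat apply Rmult_le_pos; lra).
      (* Compare squares: [s^2 = 2 * N <= 2 + 2 * q * h], while [q > 1 / 2] and [g^2 >= 4 * (h + 2)]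
         give [a^2 >= 2 * q * (h + 2)]. *)
      assert (Hs : s <= a).
      { assert (H0 : 1 / 4 <= q * q) by (clear - Hq2; nra).
        assert (H1 : 1 / 8 <= q * q * q) by (clear - H0 Hq2; nra).
        assert (H2 : q / 2 <= 4 * (q * q * q) * q) by (clear - H1 Hq2; nra).
        assert (H3 : 4 * (h + 2) <= g * g) by (clear - Hgh2 Hyh Hy2; nra).
        assert (H4 : q / 2 * (4 * (h + 2)) <= q / 2 * (g * g))
          by (apply Rmult_le_compat_l; lra).
        assert (H5 : q / 2 * (g * g) <= 4 * (q * q * q) * q * (g * g))
          by (apply Rmult_le_compat_r; nra).
        assert (H6 : s * s <= a * a) by (unfold a; lra).
        clear - Ha H6 Hs0. nra. }
      assert (H3 : 2 * (s - 1) <= s * (ln s + ln s)).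
      { replace (2 * (s - 1)) with (s * (2 * (1 - / s))) by (field; lra).
        apply Rmult_le_compat_l; lra. }
      assert (0 < ln s) by (rewrite <- ln_1; apply ln_increasing; lra).
      (* Here [N = s^2 / 2] and [q * q * g = a / 2 >= s / 2]. Since [(s + 1) * (s - 1) = m - 1], the
         bound on [ln s] then suffices. *)
      assert (H5 : s * (s + 1) / 2 * (ln s + ln s) <= (N + q * q * g) * (ln s + ln s)).
      { apply Rmult_le_compat_r; [lra|]. unfold a in Hs. lra. }
      assert (H6 : (s + 1) / 2 * (2 * (s - 1)) <= (s + 1) / 2 * (s * (ln s + ln s)))
        by (apply Rmult_le_compat_l; lra).
      lra.
Qed.

(** * Equilibria *)

Lemma standard_not_equilibrium (lambda sigma b r : R) :
  0 < lambda -> 0 < sigma < 1 -> 0 < b < 1 -> sigma < b ->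
  ~ symmetric_equilibrium lambda sigma b (Posting standard r).
Proof.
  intros Hlambda Hsigma Hb Hsb [Hr Heq]. cbn [reserve] in Hr.
  destruct (exists_multiplier lambda sigma b r Hlambda Hsigma Hb Hsb Hr)
    as (m & Hm1 & HmN & Hml & Hg & Hcap & Hlow & Hgain).
  assert (Hxh : 0 <= (1 - sigma) * lambda) by nra.
  assert (Hxl : 0 < sigma * lambda) by nra.
  pose proof (Pi_surplus b (Posting standard r) _ _ Hb Hr Hxh (Rlt_le _ _ Hxl)) as HPi.
  destruct (U_standard b r _ _ Hxh Hxl) as [HUh HUl].
  set (y := sigma * lambda) in *. set (h := (exp y - 1) / y - 1) in *.
  replace ((1 - sigma) * lambda + y) with lambda in * by (unfold y; ring).
  set (g := exp y - 1 - h) in *. set (q := 1 - b) in *.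
  set (N := 1 - r + q * h) in *.
  replace (1 - r + q * (exp y - 1)) with (N + q * g) in HUh by (unfold N, g; ring).
  assert (Hq : 0 < q) by (unfold q; lra).
  set (x := lambda - ln m).
  assert (Hx : 0 < x).
  { assert (ln m < ln (exp lambda)) as H by (apply ln_increasing; lra).
    rewrite ln_exp in H. unfold x; lra. }
  assert (Hlnm : 0 <= ln m) by (rewrite <- ln_1; apply ln_le; lra).
  set (e := exp (- lambda)) in *.
  assert (He : 0 < e) by apply exp_pos.
  assert (Hex : exp (- x) = e * m).
  { unfold x, e. replace (- (lambda - ln m)) with (- lambda + ln m) by ring.
    rewrite exp_plus, exp_ln; lra. }
  assert (Hee : e * exp lambda = 1).
  { unfold e. rewrite <- exp_plus, Rplus_opp_l. apply exp_0. }
  (* The target gap is the difference of the two market utilities. *)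
  destruct (rent_gap_attained b x (e * (q * g)) Hb ltac:(lra)) as [t [Ht Hgap]].
  { split; [repeat apply Rmult_le_pos; lra|]. rewrite Hex. fold q.
    replace (1 - e * m) with (e * (exp lambda - m)) by lra.
    replace (Rmin (1 / 2) q * (e * (exp lambda - m)))
      with (e * (Rmin (1 / 2) q * (exp lambda - m))) by ring.
    apply Rmult_le_compat_l; lra. }
  destruct (ex_mean_low_rent b t x) as [s Hs]; [lra|lra|lra|].
  assert (Hs0 : 0 <= s).
  { apply (is_mean_le x (fun _ => 0) (low_rent b t)); auto using is_mean_const; [lra|].
    intros n. apply low_rent_bounds; lra. }
  (* Contested rents alone must not give low types more than their market utility. When [t > 2 * b],
     [t <= 1] forces [b < 1 / 2], so [Hlow] applies. *)
  assert (HsN : s <= e * N).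
  { destruct (Rle_dec t (2 * b)) as [Htb|Htb].
    - assert (H0 : s <= 0).
      { apply (is_mean_le x (low_rent b t) (fun _ => 0)); auto using is_mean_const; [lra|].
        intros n. right. apply low_rent_few_low; lra. }
      nra.
    - assert (H0 : s + b * z 1 x <= e * (q * g)).
      { refine (is_mean_le x _ _ _ _ ltac:(lra) _
          (is_mean_plus _ _ _ _ _ Hs (is_mean_scal _ b _ _ (is_mean_dirac x 1))) Hgap).
        intros n. apply low_rent_many_low; lra. }
      replace (z 1 x) with (e * (m * x)) in H0
        by (unfold z; simpl; rewrite Hex; field).
      specialize (Hlow ltac:(lra)). fold x in Hlow.
      assert (e * (q * g - m * (b * x)) <= e * N) by (apply Rmult_le_compat_l; lra).
      lra. }
  (* The lone buyer's payoff makes up what the rent [s] lacks of the low market utility [e * N]. *)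
  set (r' := 1 - (e * N - s) / exp (- x)).
  assert (Hr' : 0 <= r' <= 1).
  { assert (0 <= (e * N - s) / exp (- x) <= 1); [|unfold r'; lra].
    rewrite Hex. split; [apply Rdiv_le_0_compat; nra|].
    apply Rmult_le_reg_r with (e * m); [nra|].
    unfold Rdiv. rewrite Rmult_assoc, Rinv_l; nra. }
  set (xh := (1 - t) * x). set (xl := t * x).
  assert (Hsum : xh + xl = x) by (unfold xh, xl; ring).
  assert (Hxh' : 0 <= xh) by (unfold xh; nra).
  assert (Hxl' : 0 <= xl) by (unfold xl; nra).
  assert (Htheta : theta xh xl = t).
  { unfold theta. rewrite Hsum. unfold xl. field. lra. }
  destruct (U_all_pay b r' xh xl (s + e * (q * g)) s) as [HUh' HUl'].
  { rewrite Hsum, Htheta. refine (is_mean_ext _ _ _ _ _ (is_mean_plus _ _ _ _ _ Hs Hgap)).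
    intros n. unfold rent_gap. ring. }
  { now rewrite Hsum, Htheta. }
  rewrite Hsum in HUh', HUl'.
  assert (Hlevel : exp (- x) * (1 - r') = e * N - s).
  { unfold r'. field. apply Rgt_not_eq, exp_pos. }
  rewrite Hlevel in HUh', HUl'.
  apply (Heq (Posting all_pay r') Hr' ltac:(discriminate) xh xl).
  - split; [|split]; auto. fold y. intros [|].
    + rewrite HUh', HUh. lra.
    + rewrite HUl', HUl. lra.
  - fold y. rewrite HPi, (Pi_surplus b (Posting all_pay r') xh xl Hb Hr' Hxh' Hxl').
    rewrite HUh', HUl', HUh, HUl, Hsum, Hex.
    (* Fewer high types come: their share falls from [1 - sigma] to at most [1 - b]. *)
    assert (Hless : q * ln m < (1 - sigma) * lambda - xh).
    { apply Rlt_le_trans with ((1 - sigma) * lambda - (1 - b) * x).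
      - unfold q, x. nra.
      - unfold xh. nra. }
    assert (Hgq : 0 < q * g) by nra.
    (* Times [e], this is the gain in profit, as [lambda - x = ln m]; positivity combines [Hless]
       with [Hgain]. *)
    assert (0 < 1 - m + N * ln m + ((1 - sigma) * lambda - xh) * (q * g)) by nra.
    assert (Hpos : 0 < e * (1 - m + N * ln m + ((1 - sigma) * lambda - xh) * (q * g))) by nra.
    replace xl with (x - xh) by lra. unfold x, y in *. lra.
Qed.

Lemma theta_market (lambda sigma : R) : 0 < lambda ->
  theta ((1 - sigma) * lambda) (sigma * lambda) = sigma.
Proof. intros Hlambda. unfold theta. field. lra. Qed.

Lemma U_all_pay_market (lambda sigma b r : R) (i : buyer_type) :
  0 < lambda -> 0 < sigma < 1 -> 0 < b < 1 -> sigma < b ->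
  U b i (Posting all_pay r) ((1 - sigma) * lambda) (sigma * lambda) =
    exp (- lambda) * (1 - r).
Proof.
  intros Hlambda Hsigma Hb Hsb. rewrite U_all_pay_few_low.
  - now replace ((1 - sigma) * lambda + sigma * lambda) with lambda by ring.
  - nra.
  - nra.
  - rewrite theta_market; lra.
  - lra.
Qed.

Lemma all_pay_zero_equilibrium (lambda sigma b : R) :
  0 < lambda -> 0 < sigma < 1 -> 0 < b < 1 -> sigma < b ->
  symmetric_equilibrium lambda sigma b (Posting all_pay 0).
Proof.
  intros Hlambda Hsigma Hb Hsb. split; [simpl; lra|].
  intros p' Hp' _ xh xl (Hh & Hl & Hresp).
  assert (HOmega : forall (i : buyer_type), 0 < rate xh xl i -> U b i p' xh xl = exp (- lambda)).
  { intros i Hi. rewrite (proj2 (Hresp i) Hi), U_all_pay_market; lra. }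
  (* A type that stays away may have lower utility, but its term is 0 on both sides. *)
  assert (Hxh : xh * U b high p' xh xl = xh * exp (- lambda)).
  { destruct Hh as [Hh|<-]; [|lra]. now rewrite (HOmega high Hh). }
  assert (Hxl : xl * U b low p' xh xl = xl * exp (- lambda)).
  { destruct Hl as [Hl|<-]; [|lra]. now rewrite (HOmega low Hl). }
  rewrite (Pi_surplus b p') by lra.
  rewrite Pi_surplus by (simpl; nra || lra). rewrite !U_all_pay_market by lra.
  replace ((1 - sigma) * lambda + sigma * lambda) with lambda by ring.
  rewrite Hxh, Hxl.
  (* The tangent to the convex [exp (- x)] at [x = lambda] shows that total rate [lambda] maximizes
     the profit. *)
  pose proof (exp_ineq1_le (lambda - (xh + xl))) as H.
  pose proof (exp_pos (- lambda)).
  assert (H1 : exp (- (xh + xl)) = exp (- lambda) * exp (lambda - (xh + xl)))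
    by (rewrite <- exp_plus; f_equal; ring).
  assert (H2 : exp (- lambda) * (1 + (lambda - (xh + xl))) <= exp (- (xh + xl)))
    by (rewrite H1; apply Rmult_le_compat_l; lra).
  lra.
Qed.

Lemma all_pay_equilibrium_reserve (lambda sigma b r : R) :
  0 < lambda -> 0 < sigma < 1 -> 0 < b < 1 -> sigma < b ->
  symmetric_equilibrium lambda sigma b (Posting all_pay r) -> r = 0.
Proof.
  intros Hlambda Hsigma Hb Hsb [Hr Heq]. cbn [reserve] in Hr.
  destruct (Req_dec r 0) as [|Hr0]; [assumption|exfalso].
  assert (Hxh : 0 <= (1 - sigma) * lambda) by nra.
  assert (Hxl : 0 <= sigma * lambda) by nra.
  pose proof (Pi_surplus b (Posting all_pay r) _ _ Hb Hr Hxh Hxl) as HPi.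
  rewrite !U_all_pay_market in HPi by lra.
  replace ((1 - sigma) * lambda + sigma * lambda) with lambda in HPi by ring.
  destruct (Req_dec r 1) as [->|Hr1].
  (* At reserve 1 market utilities are 0. A standard store with reserve 1 and no low types also
     yields 0 at any rate, so a rate above [lambda], here [2 * lambda], is a response. *)
  - assert (Hmean : forall i, U b i (Posting standard 1) (2 * lambda) 0 = 0).
    { intros i. apply is_series_unique.
      apply is_mean_ext with (2 := is_mean_const (2 * lambda + 0) 0). intros n.
      assert (Ht : theta (2 * lambda) 0 = 0) by (unfold theta; field; lra). rewrite Ht.
      destruct (payoff_standard b 1 0 n) as [Eh El].
      destruct i; [rewrite Eh|rewrite El]; destruct n; unfold dirac; simpl; unfold Rdiv; lra. }
    apply (Heq (Posting standard 1) ltac:(simpl; lra) ltac:(discriminate) (2 * lambda) 0).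
    + repeat split; try lra; rewrite Hmean, U_all_pay_market; lra.
    + rewrite HPi, Pi_surplus by (simpl; lra). rewrite !Hmean.
      assert (exp (- (2 * lambda + 0)) < exp (- lambda)) by (apply exp_increasing; lra).
      lra.
  (* The rate at which reserve 0 gives the same utility as reserve [r] does at rate [lambda], with
     unchanged shares of types. *)
  - set (x := lambda - ln (1 - r)).
    assert (Hln : ln (1 - r) < 0) by (rewrite <- ln_1; apply ln_increasing; lra).
    assert (Hx : lambda < x) by (unfold x; lra).
    assert (Hex : exp (- x) = exp (- lambda) * (1 - r)).
    { unfold x. replace (- (lambda - ln (1 - r))) with (- lambda + ln (1 - r)) by ring.
      rewrite exp_plus, exp_ln; lra. }
    assert (HU : forall i, U b i (Posting all_pay 0) ((1 - sigma) * x) (sigma * x) =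
      exp (- lambda) * (1 - r)).
    { intros i. rewrite U_all_pay_market; lra. }
    apply (Heq (Posting all_pay 0) ltac:(simpl; lra)) with ((1 - sigma) * x) (sigma * x).
    + intros [= H]. lra.
    + split; [nra|split; [nra|]]. intros i. rewrite HU, U_all_pay_market; lra.
    + rewrite HPi, Pi_surplus by (simpl; nra || lra). rewrite !HU, <- Hex.
      replace ((1 - sigma) * x + sigma * x) with x by ring.
      (* The gain is [exp (- lambda) - exp (- x) * (1 + x - lambda)], positive by strict
         convexity. *)
      pose proof (exp_ineq1 (x - lambda) ltac:(lra)) as H.
      assert (H1 : exp (- lambda) = exp (- x) * exp (x - lambda))
        by (rewrite <- exp_plus; f_equal; ring).
      assert (H2 : exp (- x) * (1 + (x - lambda)) < exp (- lambda))
        by (rewrite H1; apply Rmult_lt_compat_l; [apply exp_pos|lra]).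
      lra.
Qed.

Theorem proposition6 :
  forall lambda sigma b : R,
    0 < lambda -> 0 < sigma < 1 -> 0 < b < 1 ->
    sigma < b ->
    exists p : posting,
      unique (symmetric_equilibrium lambda sigma b) p /\ fmt p = all_pay.
Proof.
  intros lambda sigma b Hlambda Hsigma Hb Hsb.
  exists (Posting all_pay 0). split; [split|reflexivity].
  - now apply all_pay_zero_equilibrium.
  - intros [[|] r] Heq.
    + exfalso. now apply (standard_not_equilibrium lambda sigma b r).
    + now rewrite (all_pay_equilibrium_reserve lambda sigma b r).
Qed.
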